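(* Let $h$ be a morphism from a groupoid $\Gamma$ to a groupoid $\Delta$ that is an epimorphism (in the category of groupoids with Zakrzewski morphisms). Then $h$ is surjective, i.e. $Im(h)=\Delta$.
   Context: A relation $r$ from a set $X$ to a set $Y$ is given by its graph, a subset of $Y\times X$; we write $(y,x)\in r$. Its image is $Im(r)=\{y:\exists x,\ (y,x)\in r\}$, and $r(A)=\{y:\exists x\in A,\ (y,x)\in r\}$ for $A\subset X$. Relations are composed by $(z,x)\in tr\iff\exists y:\ (z,y)\in t,\ (y,x)\in r$, and $r\times r_1=\{(y,y_1;x,x_1):(y,x)\in r,\ (y_1,x_1)\in r_1\}$. A groupoid $\Gamma\rightrightarrows E$ is a small category with all morphisms invertible; $\Gamma$ is the set of morphisms and $E=\Gamma^{(0)}\subset\Gamma$ the set of identities. $s(\gamma)$ is the inverse of $\gamma$, $e_R(\gamma)=s(\gamma)\gamma$ is its source, $e_L(\gamma)=\gamma s(\gamma)$ its target; $\gamma_1\gamma_2$ is defined iff $e_R(\gamma_1)=e_L(\gamma_2)$. The multiplication is the relation $m$ from $\Gamma\times\Gamma$ to $\Gamma$ with $(\gamma;\gamma_1,\gamma_2)\in m$ iff $\gamma_1\gamma_2$ is defined and equals $\gamma$. A (Zakrzewski) morphism from $\Gamma\rightrightarrows E$ to $\Gamma_1\rightrightarrows E_1$ is a relation $h$ from $\Gamma$ to $\Gamma_1$ such that $hm=m_1(h\times h)$, $hs=s_1h$ and $h(E)=E_1$ (here $m_1,s_1$ are the structure relations of $\Gamma_1$). Groupoids with these morphisms form a category under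 composition of relations. *)

(* Defs.v *)
From mathcomp Require Import all_boot.
From mathcomp Require Import boolp classical_sets.

Set Implicit Arguments.
Unset Strict Implicit.
Unset Printing Implicit Defensive.

Local Open Scope classical_set_scope.

(* A relation from X to Y is its graph, of type [set (Y * X)]: the target comes
   first, and [rel_comp t r] is "t after r". *)

Definition rel_comp (X Y Z : Type) (t : set (Z * Y)) (r : set (Y * X)) :
    set (Z * X) :=
  [set zx | exists2 y, t (zx.1, y) & r (y, zx.2)].

Definition rel_image (X Y : Type) (r : set (Y * X)) : set Y :=
  r.`1.

Definition rel_direct_image (X Y : Type) (r : set (Y * X)) (A : set X) : set Y :=
  [set y | exists2 x, A x & r (y, x)].

Definition rel_prod (X Y X1 Y1 : Type) (r : set (Y * X)) (r1 : set (Y1 * X1)) :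
    set ((Y * Y1) * (X * X1)) :=
  [set p | r (p.1.1, p.2.1) /\ r1 (p.1.2, p.2.2)].

(* Arrows-only presentation of a small category with all arrows invertible:
   objects are identified with identity arrows.  [gsource] is e_R, [gtarget] is
   e_L, and [gcomp x y] is meaningful only if [gsource x = gtarget y]; its other
   values are junk, never used by the axioms nor by [gmul] below. *)
Record groupoid := Groupoid {
  arrow :> Type;
  gsource : arrow -> arrow;
  gtarget : arrow -> arrow;
  gcomp : arrow -> arrow -> arrow;
  ginv : arrow -> arrow;
  gsource_source : forall x, gsource (gsource x) = gsource x;
  gtarget_source : forall x, gtarget (gsource x) = gsource x;
  gsource_target : forall x, gsource (gtarget x) = gtarget x;
  gtarget_target : forall x, gtarget (gtarget x) = gtarget x;
  gsource_comp : forall x y, gsource x = gtarget y ->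
    gsource (gcomp x y) = gsource y;
  gtarget_comp : forall x y, gsource x = gtarget y ->
    gtarget (gcomp x y) = gtarget x;
  gcompA : forall x y z, gsource x = gtarget y -> gsource y = gtarget z ->
    gcomp x (gcomp y z) = gcomp (gcomp x y) z;
  gcomp_source : forall x, gcomp x (gsource x) = x;
  gcomp_target : forall x, gcomp (gtarget x) x = x;
  gsource_inv : forall x, gsource (ginv x) = gtarget x;
  gtarget_inv : forall x, gtarget (ginv x) = gsource x;
  gcompVx : forall x, gcomp (ginv x) x = gsource x;
  gcompxV : forall x, gcomp x (ginv x) = gtarget x
}.

Definition gid (G : groupoid) : set G := [set e | gsource e = e].
Arguments gid : clear implicits.

Definition gmul (G : groupoid) : set (G * (G * G)) :=
  [set p | gsource p.2.1 = gtarget p.2.2 /\ p.1 = gcomp p.2.1 p.2.2].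
Arguments gmul : clear implicits.

Definition ginv_rel (G : groupoid) : set (G * G) :=
  [set p | p.1 = ginv p.2].
Arguments ginv_rel : clear implicits.

Definition zakrzewski_morphism (G G1 : groupoid) (h : set (G1 * G)) : Prop :=
  [/\ rel_comp h (gmul G) = rel_comp (gmul G1) (rel_prod h h),
      rel_comp h (ginv_rel G) = rel_comp (ginv_rel G1) h
    & rel_direct_image h (gid G) = gid G1].

(* All groupoids, including the test object [L], have their arrows in one and
   the same universe, i.e. they are the objects of one category. *)
Definition zakrzewski_epi (G D : groupoid) (h : set (D * G)) : Prop :=
  forall (L : groupoid) (f g : set (L * D)),
    zakrzewski_morphism f -> zakrzewski_morphism g ->
    rel_comp f h = rel_comp g h -> f = g.

(* Main.v *)
Require Import Defs.
From mathcomp Require Import all_boot.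
From mathcomp Require Import boolp classical_sets.

(** The image [S] of a morphism into [D] is a wide subgroupoid of [D]: it
    contains every identity and is closed under composition and inversion
    ([image_gid], [image_gcomp], [image_ginv]).  It remains to tell [S] apart
    from [D] by two morphisms out of [D] which agree on [S].

    A morphism from [D] to the pair groupoid on a set [T] is the same thing as
    an action of [D] on [T], so two actions of [D] on one set are wanted.  This
    follows the classical proof that epimorphisms of groups are surjective: an
    action is conjugated by a permutation that commutes with the elements of [S]
    and with no others.  The set used here is [D * bool], on which [D] acts by
    left translation of the first component, and the permutation flips the bit
    over the points of [S].  Since [S] is a subgroupoid, left translation by an
    element of [S] preserves membership in [S] both ways, hence commutes with
    the flip.  A [d] outside [S] sends its source, a point of [S], to [d]
    itself, so translation by [d] does not commute with the flip.  If [h] is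
    epi, both actions coincide and no such [d] exists. *)

Set Implicit Arguments.
Unset Strict Implicit.
Unset Printing Implicit Defensive.

Local Open Scope classical_set_scope.

Section Groupoid.
Variable D : groupoid.
Implicit Types x y : D.

Lemma gcompKV x y : gsource x = gtarget y -> gcomp (ginv x) (gcomp x y) = y.
Proof.
move=> xy; rewrite gcompA ?gsource_inv //.
by rewrite gcompVx xy gcomp_target.
Qed.

End Groupoid.

Section Image.
Variables (G D : groupoid) (h : set (D * G)).
Hypothesis hmor : zakrzewski_morphism h.

Lemma image_gid (e : D) : gsource e = e -> rel_image h e.
Proof.
case: hmor => _ _ hE ee; have : gid D e by [].
by rewrite -hE => -[x _ hx]; exists x.
Qed.

(** By the inclusion of [m1 (h x h)] in [h m], elements of [G] related to
    composable elements of [D] are themselves composable, and their composite is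
    related to the composite in [D]. *)
Lemma image_gcomp (x y : D) : gsource x = gtarget y ->
  rel_image h x -> rel_image h y -> rel_image h (gcomp x y).
Proof.
case: hmor => hm _ _ xy [a ha] [b hb].
have : rel_comp (gmul D) (rel_prod h h) (gcomp x y, (a, b)) by exists (x, y).
by rewrite -hm => -[c hc _]; exists c.
Qed.

Lemma image_ginv (x : D) : rel_image h x -> rel_image h (ginv x).
Proof.
case: hmor => _ hs _ [a ha].
have : rel_comp (ginv_rel D) h (ginv x, a) by exists x.
by rewrite -hs => -[c hc _]; exists c.
Qed.

(** This two-way form makes the flip over the image commute with translation by
    elements of the image. *)
Lemma image_gcompl (x y : D) : gsource x = gtarget y -> rel_image h x ->
  rel_image h (gcomp x y) <-> rel_image h y.
Proof.
move=> xy hx; split=> [hxy | hy]; last exact: image_gcomp.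
rewrite -(gcompKV xy); apply: image_gcomp => //; last exact: image_ginv.
by rewrite gsource_inv gtarget_comp.
Qed.

End Image.

Definition pair_groupoid (T : Type) : groupoid.
Proof.
by refine (@Groupoid (T * T)%type (fun p => (p.2, p.2)) (fun p => (p.1, p.1))
  (fun p q => (p.1, q.2)) (fun p => (p.2, p.1)) _ _ _ _ _ _ _ _ _ _ _ _ _);
  move=> [? ?] // [? ?] //=.
Defined.

(** A left action of [D] on [T] along the anchor [a], which places each point of
    [T] over an identity of [D].  The value [act d x] is constrained only when
    [x] lies over the source of [d]. *)
Record is_action (D : groupoid) (T : Type) (a : T -> D) (act : D -> T -> T) :
    Prop := IsAction {
  anchor_id : forall x, gsource (a x) = a x;
  anchor_act : forall d x, gsource d = a x -> a (act d x) = gtarget d;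
  act_id : forall x, act (a x) x = x;
  act_comp : forall c d x, gsource c = gtarget d -> gsource d = a x ->
    act (gcomp c d) x = act c (act d x)
}.

Definition action_rel (D : groupoid) (T : Type) (a : T -> D)
    (act : D -> T -> T) : set (pair_groupoid T * D) :=
  [set p | gsource p.2 = a p.1.2 /\ p.1.1 = act p.2 p.1.2].

Section Action.
Variables (D : groupoid) (T : Type) (a : T -> D) (act : D -> T -> T).
Hypothesis actP : is_action a act.

Lemma actVK (d : D) x : gsource d = a x -> act (ginv d) (act d x) = x.
Proof.
move=> dx; rewrite -(act_comp actP) ?gsource_inv //.
by rewrite gcompVx dx (act_id actP).
Qed.

Lemma actKV (d : D) x : gtarget d = a x -> act d (act (ginv d) x) = x.
Proof.
move=> dx; rewrite -(act_comp actP) ?gtarget_inv ?gsource_inv //.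
by rewrite gcompxV dx (act_id actP).
Qed.

(** The multiplication axiom is associativity of the action, read on pairs: [c]
    and [d] carry [x] to [z] exactly when they do so through the midpoint
    [act d x].  The identities of the pair groupoid are the pairs [(x, x)], each
    the trace at [x] of the identity [a x]. *)
Lemma action_rel_morphism : zakrzewski_morphism (action_rel a act).
Proof.
split; apply/seteqP; split.
- move=> [[z x] [c d]] [w [/= wx ->] [/= cd wE]].
  move: wx; rewrite wE gsource_comp // => dx.
  exists ((act c (act d x), act d x), (act d x, x)).
    by split; rewrite //= (act_comp actP).
  by split; split; rewrite //= (anchor_act actP).
- move=> [[z x] [c d]] /= [[[z1 y1] [y2 x2]] [/= y12 [? ?]]].
  move=> [[/= cy zE] [/= dx yE]].
  case: y12 => y12; subst z1 x2 y1 z y2; rewrite (anchor_act actP) // in cy.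
  exists (gcomp c d) => //.
  by split; rewrite /= ?gsource_comp ?(act_comp actP).
- move=> [[y x] d] /= [w [/= wx ->] wE].
  have {}wE : w = ginv d := wE.
  move: wx; rewrite wE gsource_inv => dx.
  exists (x, act (ginv d) x) => //; split; rewrite /= ?actKV //.
  by rewrite (anchor_act actP) ?gsource_inv // gtarget_inv.
- move=> [[y x] d] /= [[u v] [/= -> ->] [/= dv ->]].
  exists (ginv d) => //; split; rewrite /= ?actVK //.
  by rewrite (anchor_act actP) // gsource_inv.
- by move=> [y x] [d dd [/= dx ->]]; rewrite -dd dx (act_id actP).
- move=> [y x] [->]; exists (a y); first exact: (anchor_id actP).
  by split; rewrite /= ?(anchor_id actP) ?(act_id actP).
Qed.

Lemma conj_is_action (u : T -> T) : involutive u ->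
  (forall x, a (u x) = a x) -> is_action a (fun d x => u (act d (u x))).
Proof.
move=> uK au; split=> [x | d x dx | x | c d x cd dx].
- exact: (anchor_id actP).
- by rewrite au (anchor_act actP) // au.
- by rewrite -{1}au (act_id actP) uK.
- by rewrite uK (act_comp actP) // au.
Qed.

End Action.

(** Composing with [h] restricts an action to the image of [h]. *)
Lemma eq_action_rel_comp (G D : groupoid) (h : set (D * G)) (T : Type)
    (a : T -> D) (act act' : D -> T -> T) :
  (forall d x, rel_image h d -> gsource d = a x -> act d x = act' d x) ->
  rel_comp (action_rel a act) h = rel_comp (action_rel a act') h.
Proof.
move=> eq_act; apply/seteqP; split=> -[[y x] g] [d [/= dx ->] hd];
  exists d => //; split=> //=; rewrite eq_act //; by exists g.
Qed.

Definition bit_anchor (D : groupoid) (p : D * bool) : D := gtarget p.1.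

Definition bit_translate (D : groupoid) (d : D) (p : D * bool) : D * bool :=
  (gcomp d p.1, p.2).

Definition flip_over (X : Type) (S : set X) (p : X * bool) : X * bool :=
  (p.1, p.2 (+) `[< S p.1 >]).

Lemma bit_translate_action (D : groupoid) :
  is_action (@bit_anchor D) (@bit_translate D).
Proof.
rewrite /bit_anchor /bit_translate.
split=> [[x b] | d [x b] dx | [x b] | c d [x b] cd dx] /=.
- exact: gsource_target.
- exact: gtarget_comp.
- by rewrite gcomp_target.
- by rewrite gcompA.
Qed.

Lemma flip_overK (X : Type) (S : set X) : involutive (flip_over S).
Proof. by move=> [x b]; rewrite /flip_over /= addbK. Qed.

Theorem proposition3p13 (G D : groupoid) (h : set (D * G))
    (hmor : zakrzewski_morphism h) (hepi : zakrzewski_epi h) :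
  rel_image h = [set: D]%classic.
Proof.
pose u := flip_over (rel_image h).
pose act' d p := u (bit_translate d (u p)).
have actP := bit_translate_action D.
have act'P : is_action (@bit_anchor D) act'.
  by apply: (conj_is_action actP (u := u)) => //; exact: flip_overK.
have agree : rel_comp (action_rel (@bit_anchor D) (@bit_translate D)) h =
             rel_comp (action_rel (@bit_anchor D) act') h.
  apply: eq_action_rel_comp => d [x b] hd dx.
  rewrite /act' /u /flip_over /bit_translate /=.
  by rewrite (asbool_equiv_eq (image_gcompl hmor dx hd)) addbK.
have eq_rel :=
  hepi _ _ _ (action_rel_morphism actP) (action_rel_morphism act'P) agree.
apply/seteqP; split=> // d _.
(* Translation by [d] moves the point [(gsource d, false)] to [(d, false)].  The
   conjugated action starts there with a flip, as the source lies in the image,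
   so the final flip has to occur as well. *)
have : action_rel (@bit_anchor D) (@bit_translate D)
    (((d, false), (gsource d, false)), d).
  split; first by rewrite /bit_anchor /= gtarget_source.
  by rewrite /bit_translate /= gcomp_source.
rewrite eq_rel => -[_]; rewrite /act' /u /flip_over /bit_translate /=.
have hs : rel_image h (gsource d) by apply: image_gid; rewrite // gsource_source.
rewrite (asboolT hs) gcomp_source /= => -[].
by case: asboolP.
Qed.
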